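(* Let $\mathcal{C}$ be a symmetric strict monoidal category whose monoidal product is the cartesian product $\times$ (with unit the terminal object $1$). There is an identity-on-objects oplax 2-functor $$\iota : \mathbf{Lens}_{\mathrm{Cart}}(\mathcal{C}) \to \mathbf{2}\text{-}\mathbf{Optic}(\mathcal{C}),$$ where the category $\mathbf{Lens}_{\mathrm{Cart}}(\mathcal{C})$ is regarded as a locally discrete 2-category, defined as follows. - On a lens $(f,f') : (A,A') \to (B,B')$, $\iota(f,f') := (A, \mathrm{graph}(f), f')$. - The oplaxator $\delta^\iota$ assigns to every pair of lenses $(f,f') : (A,A') \to (B,B')$ and $(g,g') : (B,B') \to (C,C')$ the 2-cell $$\iota\bigl((f,f') ; (g,g')\bigr) \Rightarrow \iota(f,f') ; \iota(g,g')$$ given by the reparameterisation $\mathrm{graph}(f) : A \to A \times B$. - The opunitor $\epsilon^\iota$ assigns to every object $(A,A')$ the 2-cell $\iota(\mathrm{id}_{(A,A')}) \Rightarrow \mathrm{id}_{\iota(A,A')}$ given by the reparameterisation $!_A : A \to 1$.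
   Context: Composition is written in diagrammatic order: for $f : A \to B$ and $g : B \to C$, $f ; g : A \to C$. An object is used to denote its identity morphism, e.g. $r \times B$ means $r \times \mathrm{id}_B$. Symmetric strict monoidal means that associators and unitors are identities (the symmetry need not be). $!_A : A \to 1$ is the unique map to the terminal object. Graph: for $f : A \to B$, $\mathrm{graph}(f) : A \to A \times B$ is $\Delta_A ; (A \times f)$, where $\Delta_A : A \to A \times A$ is the diagonal. The category $\mathbf{Lens}_{\mathrm{Cart}}(\mathcal{C})$ of cartesian lenses: objects are pairs $(A,A')$ of objects of $\mathcal{C}$; a morphism $(A,A') \to (B,B')$ is a pair $(f,f')$ with $f : A \to B$ and $f' : A \times B' \to A'$. The composite of $(f,f') : (A,A') \to (B,B')$ and $(g,g') : (B,B') \to (C,C')$ has first component $f ; g$ and second component $$A \times C' \xrightarrow{\mathrm{graph}(f) \times C'} A \times B \times C' \xrightarrow{A \times g'} A \times B' \xrightarrow{f'} A'.$$ The identity on $(A,A')$ is $(\mathrm{id}_A, \pi_2 : A \times A' \to A')$. The 2-category $\mathbf{2}\text{-}\mathbf{Optic}(\mathcal{C})$ (here with $\otimes = \times$ and $I = 1$): objects are pairs $(A,A')$ of objects of $\mathcal{C}$. A 1-cell $(A,A') \to (B,B')$ is a triple $(M, \mathsf{fw}, \mathsf{bw})$ with $M$ an object of $\mathcal{C}$, $\mathsf{fw} : A \to M \otimes B$ and $\mathsf{bw} : M \otimes B' \to A'$. A 2-cell $(M_1, \mathsf{fw}_1, \mathsf{bw}_1) \Rightarrow (M_2, \mathsf{fw}_2,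 \mathsf{bw}_2)$ (a reparameterisation) is a morphism $r : M_1 \to M_2$ of $\mathcal{C}$ such that $\mathsf{fw}_1 ; (r \otimes B) = \mathsf{fw}_2$ and $(r \otimes B') ; \mathsf{bw}_2 = \mathsf{bw}_1$; vertical composition and identities are those of $\mathcal{C}$. The composite of $(M_1, \mathsf{fw}_1, \mathsf{bw}_1) : (A,A') \to (B,B')$ and $(M_2, \mathsf{fw}_2, \mathsf{bw}_2) : (B,B') \to (C,C')$ is $$\bigl(M_1 \otimes M_2,\ \mathsf{fw}_1 ; (M_1 \otimes \mathsf{fw}_2),\ (M_1 \otimes \mathsf{bw}_2) ; \mathsf{bw}_1\bigr),$$ horizontal composition of 2-cells $r$, $s$ is $r \otimes s$, and the identity 1-cell on $(A,A')$ is $(I, \mathrm{id}_A, \mathrm{id}_{A'})$. Oplax 2-functor is meant in the usual sense: functors on hom-categories together with natural 2-cells $\iota(p;q) \Rightarrow \iota(p);\iota(q)$ (oplaxator) and $\iota(\mathrm{id}) \Rightarrow \mathrm{id}$ (opunitor) satisfying the oplax associativity and left and right unity axioms. *)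

(* Defs.v *)
From Stdlib Require Import ProofIrrelevance.

Set Implicit Arguments.
Unset Strict Implicit.

Declare Scope cat_scope.
Delimit Scope cat_scope with cat.
Open Scope cat_scope.

(** Composition is in diagrammatic order everywhere. *)
Record Category := {
  Ob :> Type;
  Hom : Ob -> Ob -> Type;
  idm : forall A, Hom A A;
  comp : forall A B C, Hom A B -> Hom B C -> Hom A C;
  comp_id_l : forall A B (f : Hom A B), comp (idm A) f = f;
  comp_id_r : forall A B (f : Hom A B), comp f (idm B) = f;
  comp_assoc : forall A B C D (f : Hom A B) (g : Hom B C) (h : Hom C D),
    comp (comp f g) h = comp f (comp g h)
}.

Arguments idm {c} A.
Notation "f ;; g" := (comp f g) (at level 50, left associativity) : cat_scope.

(** The identity of [A], viewed as a morphism to the equal object [B].  All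
    "strict" structure below is strict up to these casts: an associator or
    unitor "is an identity" when it is [idcast] of an equality of objects. *)
Definition idcast (C : Category) (A B : C) (e : A = B) : Hom A B :=
  match e in _ = X return Hom A X with eq_refl => idm A end.

Definition discrete (T : Type) : Category.
Proof.
  refine (@Build_Category T (fun x y => x = y) (@eq_refl T) (@eq_trans T) _ _ _);
    abstract (intros; apply proof_irrelevance).
Defined.

Lemma idcast_id (C : Category) (A : C) (e : A = A) : idcast e = idm A.
Proof. now rewrite (proof_irrelevance _ e eq_refl). Qed.

Lemma idcast_comp (C : Category) (X Y Z : C) (e : X = Y) (e' : Y = Z) :
  idcast e ;; idcast e' = idcast (eq_trans e e').
Proof. destruct e'; apply comp_id_r. Qed.

Lemma idcast_inv_r (C : Category) (X Y : C) (e : X = Y) :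
  idcast e ;; idcast (eq_sym e) = idm X.
Proof. rewrite idcast_comp; apply idcast_id. Qed.

Lemma idcast_inv_l (C : Category) (X Y : C) (e : X = Y) :
  idcast (eq_sym e) ;; idcast e = idm Y.
Proof. rewrite idcast_comp; apply idcast_id. Qed.

(** Pentagon and triangle hold automatically, since the associators and
    unitors are casts; compatibility of the braiding with the unitors follows
    from the hexagon. *)
Record SymStrictMonCat := {
  smc_cat :> Category;
  tens : smc_cat -> smc_cat -> smc_cat;
  tensm : forall A A' B B' : smc_cat,
    Hom A A' -> Hom B B' -> Hom (tens A B) (tens A' B');
  tensm_id : forall A B, tensm (idm A) (idm B) = idm (tens A B);
  tensm_comp : forall (A A' A'' B B' B'' : smc_cat)
    (f : Hom A A') (f' : Hom A' A'') (g : Hom B B') (g' : Hom B' B''),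
    tensm (f ;; f') (g ;; g') = tensm f g ;; tensm f' g';
  munit : smc_cat;
  tens_assoc : forall A B C, tens (tens A B) C = tens A (tens B C);
  tens_unit_l : forall A, tens munit A = A;
  tens_unit_r : forall A, tens A munit = A;
  tensm_assoc : forall (A A' B B' C C' : smc_cat)
    (f : Hom A A') (g : Hom B B') (h : Hom C C'),
    tensm (tensm f g) h ;; idcast (tens_assoc A' B' C')
    = idcast (tens_assoc A B C) ;; tensm f (tensm g h);
  tensm_unit_l : forall (A A' : smc_cat) (f : Hom A A'),
    tensm (idm munit) f ;; idcast (tens_unit_l A') = idcast (tens_unit_l A) ;; f;
  tensm_unit_r : forall (A A' : smc_cat) (f : Hom A A'),
    tensm f (idm munit) ;; idcast (tens_unit_r A') = idcast (tens_unit_r A) ;; f;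
  braid : forall A B, Hom (tens A B) (tens B A);
  braid_nat : forall (A A' B B' : smc_cat) (f : Hom A A') (g : Hom B B'),
    tensm f g ;; braid A' B' = braid A B ;; tensm g f;
  braid_invol : forall A B, braid A B ;; braid B A = idm (tens A B);
  braid_hexagon : forall A B C,
    idcast (tens_assoc A B C) ;; braid A (tens B C) ;; idcast (tens_assoc B C A)
    = tensm (braid A B) (idm C) ;; idcast (tens_assoc B A C)
      ;; tensm (idm B) (braid A C)
}.

Arguments munit {s}.
Arguments braid {s} A B.
Notation "A ⊗ B" := (tens A B) (at level 40, left associativity) : cat_scope.
Notation "f ⊗m g" := (tensm f g) (at level 40, left associativity) : cat_scope.

(** [α] is the identity [(A ⊗ B) ⊗ C = A ⊗ (B ⊗ C)], [α'] its inverse. *)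
Definition α {C : SymStrictMonCat} (X Y Z : C) : Hom (X ⊗ Y ⊗ Z) (X ⊗ (Y ⊗ Z)) :=
  idcast (tens_assoc X Y Z).
Definition α' {C : SymStrictMonCat} (X Y Z : C) : Hom (X ⊗ (Y ⊗ Z)) (X ⊗ Y ⊗ Z) :=
  idcast (eq_sym (tens_assoc X Y Z)).
Definition unitl {C : SymStrictMonCat} (X : C) : Hom (munit ⊗ X) X :=
  idcast (tens_unit_l X).
Definition unitl' {C : SymStrictMonCat} (X : C) : Hom X (munit ⊗ X) :=
  idcast (eq_sym (tens_unit_l X)).

(** The tensor of objects is a product, the tensor of morphisms is the induced
    product morphism, and the identifications [A × 1 = A = 1 × A] are the
    canonical ones (the projections).  Compatibility of the strict associator
    and of the braiding with the projections follows. *)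
Record CartSymStrictMonCat := {
  cart_smc :> SymStrictMonCat;
  bang : forall A : cart_smc, Hom A munit;
  bang_uniq : forall (A : cart_smc) (f : Hom A munit), f = bang A;
  pr1 : forall A B : cart_smc, Hom (A ⊗ B) A;
  pr2 : forall A B : cart_smc, Hom (A ⊗ B) B;
  pair : forall X A B : cart_smc, Hom X A -> Hom X B -> Hom X (A ⊗ B);
  pair_pr1 : forall (X A B : cart_smc) (f : Hom X A) (g : Hom X B),
    pair f g ;; pr1 A B = f;
  pair_pr2 : forall (X A B : cart_smc) (f : Hom X A) (g : Hom X B),
    pair f g ;; pr2 A B = g;
  pair_uniq : forall (X A B : cart_smc) (h : Hom X (A ⊗ B)),
    h = pair (h ;; pr1 A B) (h ;; pr2 A B);
  tensm_pair : forall (A A' B B' : cart_smc) (f : Hom A A') (g : Hom B B'),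
    f ⊗m g = pair (pr1 A B ;; f) (pr2 A B ;; g);
  unit_l_pr2 : forall A : cart_smc, idcast (tens_unit_l A) = pr2 munit A;
  unit_r_pr1 : forall A : cart_smc, idcast (tens_unit_r A) = pr1 A munit
}.

Arguments bang {c} A.
Arguments pr1 {c} A B.
Arguments pr2 {c} A B.

Definition diag {C : CartSymStrictMonCat} (A : C) : Hom A (A ⊗ A) :=
  pair (idm A) (idm A).

Definition graph {C : CartSymStrictMonCat} {A B : C} (f : Hom A B) : Hom A (A ⊗ B) :=
  diag A ;; (idm A ⊗m f).

(** [comp1_assoc], [comp1_id_l], [comp1_id_r] are equalities of 1-cells;
    the corresponding laws for horizontal composition of 2-cells hold up to
    the casts along them. *)
Record TwoCategory := {
  Ob2 :> Type;
  hom : Ob2 -> Ob2 -> Category;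
  id1 : forall A, hom A A;
  comp1 : forall A B C, hom A B -> hom B C -> hom A C;
  hcomp : forall A B C (p p' : hom A B) (q q' : hom B C),
    Hom p p' -> Hom q q' -> Hom (comp1 p q) (comp1 p' q');
  hcomp_id : forall A B C (p : hom A B) (q : hom B C),
    hcomp (idm p) (idm q) = idm (comp1 p q);
  hcomp_comp : forall A B C (p p' p'' : hom A B) (q q' q'' : hom B C)
    (a : Hom p p') (a' : Hom p' p'') (b : Hom q q') (b' : Hom q' q''),
    hcomp (a ;; a') (b ;; b') = hcomp a b ;; hcomp a' b';
  comp1_assoc : forall A B C D (p : hom A B) (q : hom B C) (r : hom C D),
    comp1 (comp1 p q) r = comp1 p (comp1 q r);
  comp1_id_l : forall A B (p : hom A B), comp1 (id1 A) p = p;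
  comp1_id_r : forall A B (p : hom A B), comp1 p (id1 B) = p;
  hcomp_assoc : forall A B C D (p p' : hom A B) (q q' : hom B C) (r r' : hom C D)
    (a : Hom p p') (b : Hom q q') (c : Hom r r'),
    hcomp (hcomp a b) c ;; idcast (comp1_assoc p' q' r')
    = idcast (comp1_assoc p q r) ;; hcomp a (hcomp b c);
  hcomp_id_l : forall A B (p p' : hom A B) (a : Hom p p'),
    hcomp (idm (id1 A)) a ;; idcast (comp1_id_l p') = idcast (comp1_id_l p) ;; a;
  hcomp_id_r : forall A B (p p' : hom A B) (a : Hom p p'),
    hcomp a (idm (id1 B)) ;; idcast (comp1_id_r p') = idcast (comp1_id_r p) ;; a
}.

Arguments id1 {t} A.

Definition locally_discrete (C : Category) : TwoCategory.
Proof.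
  refine (@Build_TwoCategory C (fun A B => discrete (Hom A B))
    (@idm C) (@comp C)
    (fun A B D p p' q q' (a : p = p') (b : q = q') => f_equal2 (@comp C A B D) a b)
    _ _ (@comp_assoc C) (@comp_id_l C) (@comp_id_r C) _ _ _);
  abstract (intros; refine (proof_irrelevance (_ = _) _ _)).
Defined.

(** Oplax 2-functors [D -> E] whose action on objects is [F0] and on 1-cells is
    [F1].  These two are parameters rather than fields so that an oplaxator or
    opunitor component can be compared with a given 2-cell without transport. *)
Record OplaxFunctor (D E : TwoCategory) (F0 : D -> E)
    (F1 : forall A B : D, hom A B -> hom (F0 A) (F0 B)) := {
  F2 : forall (A B : D) (p p' : hom A B), Hom p p' -> Hom (F1 A B p) (F1 A B p');
  F2_id : forall (A B : D) (p : hom A B), F2 (idm p) = idm (F1 A B p);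
  F2_comp : forall (A B : D) (p p' p'' : hom A B) (a : Hom p p') (a' : Hom p' p''),
    F2 (a ;; a') = F2 a ;; F2 a';
  oplaxator : forall (A B C : D) (p : hom A B) (q : hom B C),
    Hom (F1 A C (comp1 p q)) (comp1 (F1 A B p) (F1 B C q));
  opunitor : forall A : D, Hom (F1 A A (id1 A)) (id1 (F0 A));
  oplaxator_nat : forall (A B C : D) (p p' : hom A B) (q q' : hom B C)
    (a : Hom p p') (b : Hom q q'),
    F2 (hcomp a b) ;; oplaxator p' q' = oplaxator p q ;; hcomp (F2 a) (F2 b);
  oplax_assoc : forall (A B C G : D) (p : hom A B) (q : hom B C) (r : hom C G),
    oplaxator (comp1 p q) r ;; hcomp (oplaxator p q) (idm (F1 C G r))
      ;; idcast (comp1_assoc (F1 A B p) (F1 B C q) (F1 C G r))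
    = F2 (idcast (comp1_assoc p q r))
      ;; oplaxator p (comp1 q r) ;; hcomp (idm (F1 A B p)) (oplaxator q r);
  oplax_unit_l : forall (A B : D) (p : hom A B),
    oplaxator (id1 A) p ;; hcomp (opunitor A) (idm (F1 A B p))
      ;; idcast (comp1_id_l (F1 A B p))
    = F2 (idcast (comp1_id_l p));
  oplax_unit_r : forall (A B : D) (p : hom A B),
    oplaxator p (id1 B) ;; hcomp (idm (F1 A B p)) (opunitor B)
      ;; idcast (comp1_id_r (F1 A B p))
    = F2 (idcast (comp1_id_r p))
}.

Arguments oplaxator {D E F0 F1} o {A B C} p q.
Arguments opunitor {D E F0 F1} o A.

Section CastCalculus.
Context {C : SymStrictMonCat}.

Lemma tensm_idcast_l (X Y Y' : C) (e : Y = Y') :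
  idm X ⊗m idcast e = idcast (f_equal (@tens C X) e).
Proof. destruct e; cbn; apply tensm_id. Qed.

Lemma tensm_idcast_r (X X' Y : C) (e : X = X') :
  idcast e ⊗m idm Y = idcast (f_equal (fun Z => Z ⊗ Y) e).
Proof. destruct e; cbn; apply tensm_id. Qed.

Lemma idcast_nat_inv (X X' Y Y' : C) (e : X = Y) (e' : X' = Y')
    (f : Hom X X') (g : Hom Y Y') :
  f ;; idcast e' = idcast e ;; g ->
  idcast (eq_sym e) ;; f = g ;; idcast (eq_sym e').
Proof.
  destruct e, e'; cbn; rewrite !comp_id_l, !comp_id_r; auto.
Qed.

Lemma α'_nat (X X' Y Y' Z Z' : C) (f : Hom X X') (g : Hom Y Y') (h : Hom Z Z') :
  α' X Y Z ;; (f ⊗m g ⊗m h) = (f ⊗m (g ⊗m h)) ;; α' X' Y' Z'.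
Proof. apply idcast_nat_inv, tensm_assoc. Qed.

Lemma α_nat (X X' Y Y' Z Z' : C) (f : Hom X X') (g : Hom Y Y') (h : Hom Z Z') :
  (f ⊗m g ⊗m h) ;; α X' Y' Z' = α X Y Z ;; (f ⊗m (g ⊗m h)).
Proof. apply tensm_assoc. Qed.

Lemma tensm_comp_r (X Y Y' Y'' : C) (f : Hom Y Y') (g : Hom Y' Y'') :
  idm X ⊗m (f ;; g) = (idm X ⊗m f) ;; (idm X ⊗m g).
Proof. now rewrite <- tensm_comp, comp_id_l. Qed.

Lemma tensm_comp_l (X X' X'' Y : C) (f : Hom X X') (g : Hom X' X'') :
  (f ;; g) ⊗m idm Y = (f ⊗m idm Y) ;; (g ⊗m idm Y).
Proof. now rewrite <- tensm_comp, comp_id_l. Qed.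

Lemma tensm_lr (X X' Y Y' : C) (f : Hom X X') (g : Hom Y Y') :
  (f ⊗m idm Y) ;; (idm X' ⊗m g) = f ⊗m g.
Proof. now rewrite <- !tensm_comp, !comp_id_l, !comp_id_r. Qed.

Lemma tensm_rl (X X' Y Y' : C) (f : Hom X X') (g : Hom Y Y') :
  (idm X ⊗m g) ;; (f ⊗m idm Y') = f ⊗m g.
Proof. now rewrite <- !tensm_comp, !comp_id_l, !comp_id_r. Qed.

End CastCalculus.

Record Optic {C : SymStrictMonCat} (X Y : C * C) := mkOptic {
  residual : C;
  fw : Hom (fst X) (residual ⊗ fst Y);
  bw : Hom (residual ⊗ snd Y) (snd X)
}.

Record Reparam {C : SymStrictMonCat} {X Y : C * C} (p q : Optic X Y) := mkReparam {
  reparam : Hom (residual p) (residual q);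
  reparam_fw : fw p ;; (reparam ⊗m idm (fst Y)) = fw q;
  reparam_bw : (reparam ⊗m idm (snd Y)) ;; bw q = bw p
}.

Lemma Reparam_eq {C : SymStrictMonCat} {X Y : C * C} (p q : Optic X Y)
    (r s : Reparam p q) : reparam r = reparam s -> r = s.
Proof.
  destruct r as [r Hr Hr'], s as [s Hs Hs']; cbn; intros <-.
  f_equal; apply proof_irrelevance.
Qed.

Lemma Optic_eq {C : SymStrictMonCat} {X Y : C * C} (p q : Optic X Y)
    (e : residual p = residual q) :
  fw p ;; (idcast e ⊗m idm (fst Y)) = fw q ->
  (idcast e ⊗m idm (snd Y)) ;; bw q = bw p -> p = q.
Proof.
  destruct p as [M f b], q as [N g c]; cbn in *; destruct e; cbn.
  rewrite !tensm_id, comp_id_l, comp_id_r; now intros <- <-.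
Qed.

Definition reparam_id {C : SymStrictMonCat} {X Y : C * C} (p : Optic X Y) : Reparam p p.
Proof.
  refine (@mkReparam C X Y p p (idm (residual p)) _ _).
  - abstract (rewrite tensm_id; apply comp_id_r).
  - abstract (rewrite tensm_id; apply comp_id_l).
Defined.

Definition reparam_comp {C : SymStrictMonCat} {X Y : C * C} (p q s : Optic X Y)
    (a : Reparam p q) (b : Reparam q s) : Reparam p s.
Proof.
  refine (@mkReparam C X Y p s (reparam a ;; reparam b) _ _).
  - abstract (rewrite tensm_comp_l, <- comp_assoc, !reparam_fw; reflexivity).
  - abstract (rewrite tensm_comp_l, comp_assoc, !reparam_bw; reflexivity).
Defined.

Definition OpticHom {C : SymStrictMonCat} (X Y : C * C) : Category.
Proof.
  refine (@Build_Category (Optic X Y) (@Reparam C X Y)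
    (@reparam_id C X Y) (@reparam_comp C X Y) _ _ _).
  - abstract (intros; apply Reparam_eq, comp_id_l).
  - abstract (intros; apply Reparam_eq, comp_id_r).
  - abstract (intros; apply Reparam_eq, comp_assoc).
Defined.

Definition optic_id {C : SymStrictMonCat} (X : C * C) : Optic X X :=
  mkOptic (unitl' (fst X)) (unitl (snd X)).

Definition optic_comp {C : SymStrictMonCat} {X Y Z : C * C}
    (p : Optic X Y) (q : Optic Y Z) : Optic X Z :=
  @mkOptic C X Z (residual p ⊗ residual q)
    (fw p ;; (idm (residual p) ⊗m fw q) ;; α' (residual p) (residual q) (fst Z))
    (α (residual p) (residual q) (snd Z) ;; (idm (residual p) ⊗m bw q) ;; bw p).

Lemma optic_hcomp_fw {C : SymStrictMonCat} {X Y Z : C * C}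
    (p p' : Optic X Y) (q q' : Optic Y Z) (r : Reparam p p') (s : Reparam q q') :
  fw (optic_comp p q) ;; (reparam r ⊗m reparam s ⊗m idm (fst Z))
  = fw (optic_comp p' q').
Proof.
  cbn; rewrite comp_assoc, α'_nat, comp_assoc, <- (comp_assoc (idm _ ⊗m _)).
  rewrite <- tensm_comp, comp_id_l, reparam_fw.
  rewrite <- (tensm_lr (reparam r)), <- !comp_assoc, reparam_fw; reflexivity.
Qed.

Lemma optic_hcomp_bw {C : SymStrictMonCat} {X Y Z : C * C}
    (p p' : Optic X Y) (q q' : Optic Y Z) (r : Reparam p p') (s : Reparam q q') :
  (reparam r ⊗m reparam s ⊗m idm (snd Z)) ;; bw (optic_comp p' q')
  = bw (optic_comp p q).
Proof.
  cbn; rewrite <- !comp_assoc, α_nat, (comp_assoc (α _ _ _)), <- tensm_comp.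
  rewrite comp_id_r, reparam_bw, <- tensm_rl, !comp_assoc, reparam_bw; reflexivity.
Qed.

Definition optic_hcomp {C : SymStrictMonCat} {X Y Z : C * C}
    (p p' : Optic X Y) (q q' : Optic Y Z) (r : Reparam p p') (s : Reparam q q') :
    Reparam (optic_comp p q) (optic_comp p' q') :=
  @mkReparam C X Z (optic_comp p q) (optic_comp p' q')
    (reparam r ⊗m reparam s) (optic_hcomp_fw r s) (optic_hcomp_bw r s).

Lemma reparam_idcast {C : SymStrictMonCat} {X Y : C * C} (p q : Optic X Y)
    (e : p = q) (e' : residual p = residual q) :
  reparam (@idcast (OpticHom X Y) p q e) = idcast e'.
Proof. destruct e; symmetry; apply idcast_id. Qed.

Lemma optic_comp_assoc {C : SymStrictMonCat} (W X Y Z : C * C)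
    (p : Optic W X) (q : Optic X Y) (r : Optic Y Z) :
  optic_comp (optic_comp p q) r = optic_comp p (optic_comp q r).
Proof.
  apply (@Optic_eq C W Z (optic_comp (optic_comp p q) r)
    (optic_comp p (optic_comp q r)) (tens_assoc (residual p) (residual q) (residual r))); cbn.
  - rewrite !tensm_comp_r, !comp_assoc; do 2 f_equal.
    rewrite <- tensm_id, <- (comp_assoc (α' _ _ _)), α'_nat, !comp_assoc; f_equal.
    unfold α'; rewrite tensm_idcast_r, tensm_idcast_l, !idcast_comp.
    f_equal; apply proof_irrelevance.
  - rewrite !tensm_comp_r, <- !comp_assoc; do 2 f_equal.
    rewrite <- tensm_id, (comp_assoc (α _ _ _) (idm _ ⊗m idm _ ⊗m _)), α_nat.
    rewrite <- !comp_assoc; f_equal.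
    unfold α; rewrite tensm_idcast_r, tensm_idcast_l, !idcast_comp.
    f_equal; apply proof_irrelevance.
Qed.

Lemma optic_comp_id_l {C : SymStrictMonCat} (X Y : C * C) (p : Optic X Y) :
  optic_comp (optic_id X) p = p.
Proof.
  apply (@Optic_eq C X Y (optic_comp (optic_id X) p) p (tens_unit_l (residual p))); cbn.
  - unfold unitl'.
    rewrite (idcast_nat_inv (tensm_unit_l (fw p))), !comp_assoc.
    unfold α'; rewrite tensm_idcast_r, !idcast_comp, idcast_id; apply comp_id_r.
  - unfold unitl, α; rewrite comp_assoc, tensm_unit_l, <- comp_assoc.
    rewrite tensm_idcast_r, idcast_comp.
    f_equal; f_equal; apply proof_irrelevance.
Qed.

Lemma optic_comp_id_r {C : SymStrictMonCat} (X Y : C * C) (p : Optic X Y) :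
  optic_comp p (optic_id Y) = p.
Proof.
  apply (@Optic_eq C X Y (optic_comp p (optic_id Y)) p (tens_unit_r (residual p))); cbn.
  - unfold unitl', α'; rewrite !comp_assoc, tensm_idcast_r, tensm_idcast_l.
    rewrite !idcast_comp, idcast_id; apply comp_id_r.
  - unfold unitl, α; rewrite tensm_idcast_r, tensm_idcast_l, idcast_comp.
    f_equal; f_equal; apply proof_irrelevance.
Qed.

Definition TwoOptic (C : SymStrictMonCat) : TwoCategory.
Proof.
  refine (@Build_TwoCategory (C * C) (@OpticHom C) (@optic_id C) (@optic_comp C)
    (@optic_hcomp C) _ _ (@optic_comp_assoc C) (@optic_comp_id_l C)
    (@optic_comp_id_r C) _ _ _).
  - abstract (intros; apply Reparam_eq, tensm_id).
  - abstract (intros; apply Reparam_eq, tensm_comp).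
  - abstract (intros; apply Reparam_eq; cbn;
      rewrite (reparam_idcast (optic_comp_assoc p q r) (tens_assoc _ _ _)),
        (reparam_idcast (optic_comp_assoc p' q' r') (tens_assoc _ _ _));
      apply tensm_assoc).
  - abstract (intros; apply Reparam_eq; cbn;
      rewrite (reparam_idcast (optic_comp_id_l p) (tens_unit_l _)),
        (reparam_idcast (optic_comp_id_l p') (tens_unit_l _));
      apply tensm_unit_l).
  - abstract (intros; apply Reparam_eq; cbn;
      rewrite (reparam_idcast (optic_comp_id_r p) (tens_unit_r _)),
        (reparam_idcast (optic_comp_id_r p') (tens_unit_r _));
      apply tensm_unit_r).
Defined.

Section ProductCalculus.
Context {C : CartSymStrictMonCat}.

Lemma pair_ext (X Y Z : C) (f g : Hom X (Y ⊗ Z)) :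
  f ;; pr1 Y Z = g ;; pr1 Y Z -> f ;; pr2 Y Z = g ;; pr2 Y Z -> f = g.
Proof. intros H1 H2; rewrite (pair_uniq f), (pair_uniq g); congruence. Qed.

Lemma comp_pair (W X Y Z : C) (h : Hom W X) (f : Hom X Y) (g : Hom X Z) :
  h ;; pair f g = pair (h ;; f) (h ;; g).
Proof. apply pair_ext; now rewrite ?comp_assoc, ?pair_pr1, ?pair_pr2. Qed.

Lemma comp_pair_comp (V W X Y Z : C) (h : Hom W X) (f : Hom X Y) (g : Hom X Z)
    (k : Hom (Y ⊗ Z) V) :
  h ;; (pair f g ;; k) = pair (h ;; f) (h ;; g) ;; k.
Proof. now rewrite <- comp_assoc, comp_pair. Qed.

Lemma pair_pr1_comp (W X Y Z : C) (f : Hom X Y) (g : Hom X Z) (h : Hom Y W) :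
  pair f g ;; (pr1 Y Z ;; h) = f ;; h.
Proof. now rewrite <- comp_assoc, pair_pr1. Qed.

Lemma pair_pr2_comp (W X Y Z : C) (f : Hom X Y) (g : Hom X Z) (h : Hom Z W) :
  pair f g ;; (pr2 Y Z ;; h) = g ;; h.
Proof. now rewrite <- comp_assoc, pair_pr2. Qed.

Lemma pair_pr (X Y : C) : pair (pr1 X Y) (pr2 X Y) = idm (X ⊗ Y).
Proof. rewrite (pair_uniq (idm (X ⊗ Y))), !comp_id_l; reflexivity. Qed.

Lemma graph_pair (X Y : C) (f : Hom X Y) : graph f = pair (idm X) f.
Proof.
  unfold graph, diag.
  now rewrite tensm_pair, comp_pair, pair_pr1_comp, pair_pr2_comp, !comp_id_l.
Qed.

Lemma pr1_unit (X Y : C) : pr1 X Y = (idm X ⊗m bang Y) ;; idcast (tens_unit_r X).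
Proof. now rewrite unit_r_pr1, tensm_pair, pair_pr1, comp_id_r. Qed.

Lemma pr2_unit (X Y : C) : pr2 X Y = (bang X ⊗m idm Y) ;; idcast (tens_unit_l Y).
Proof. now rewrite unit_l_pr2, tensm_pair, pair_pr2, comp_id_r. Qed.

Lemma bang_tens (X Y : C) : bang (X ⊗ Y) = (bang X ⊗m bang Y) ;; unitl munit.
Proof. symmetry; apply bang_uniq. Qed.

Lemma idcast_irr (X Y : C) (e e' : X = Y) : idcast e = idcast e'.
Proof. f_equal; apply proof_irrelevance. Qed.

Lemma α_pr1 (X Y Z : C) : α X Y Z ;; pr1 X (Y ⊗ Z) = pr1 (X ⊗ Y) Z ;; pr1 X Y.
Proof.
  rewrite pr1_unit, bang_tens, tensm_comp_r, <- !comp_assoc, <- α_nat.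
  rewrite (pr1_unit X Y), (pr1_unit (X ⊗ Y) Z), <- comp_assoc.
  rewrite (comp_assoc _ (idcast _) (idm X ⊗m bang Y)), <- tensm_unit_r.
  rewrite <- comp_assoc, <- tensm_comp, comp_id_l, comp_id_r, !comp_assoc.
  f_equal.
  unfold α, unitl; rewrite tensm_idcast_l, !idcast_comp; apply idcast_irr.
Qed.

Lemma α_pr2 (X Y Z : C) :
  α X Y Z ;; pr2 X (Y ⊗ Z) = pair (pr1 (X ⊗ Y) Z ;; pr2 X Y) (pr2 (X ⊗ Y) Z).
Proof.
  transitivity (pr2 X Y ⊗m idm Z).
  - rewrite !pr2_unit, <- comp_assoc, <- (tensm_id Y Z), <- α_nat.
    rewrite tensm_comp_l, comp_assoc; f_equal.
    unfold α; rewrite tensm_idcast_r, idcast_comp; apply idcast_irr.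
  - now rewrite tensm_pair, comp_id_r.
Qed.

Lemma α_pair (X Y Z : C) :
  α X Y Z = pair (pr1 (X ⊗ Y) Z ;; pr1 X Y)
                 (pair (pr1 (X ⊗ Y) Z ;; pr2 X Y) (pr2 (X ⊗ Y) Z)).
Proof. rewrite (pair_uniq (α X Y Z)), α_pr1, α_pr2; reflexivity. Qed.

End ProductCalculus.

Record Lens {C : CartSymStrictMonCat} (X Y : C * C) := mkLens {
  get : Hom (fst X) (fst Y);
  put : Hom (fst X ⊗ snd Y) (snd X)
}.

Definition lens_id {C : CartSymStrictMonCat} (X : C * C) : Lens X X :=
  mkLens (idm (fst X)) (pr2 (fst X) (snd X)).

Definition lens_comp {C : CartSymStrictMonCat} (X Y Z : C * C)
    (f : Lens X Y) (g : Lens Y Z) : Lens X Z :=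
  @mkLens C X Z (get f ;; get g)
    ((graph (get f) ⊗m idm (snd Z)) ;; α (fst X) (fst Y) (snd Z)
      ;; (idm (fst X) ⊗m put g) ;; put f).

Local Ltac product_normalize :=
  rewrite !tensm_pair, ?graph_pair, !α_pair;
  repeat rewrite ?comp_assoc, ?comp_pair, ?comp_pair_comp, ?pair_pr1, ?pair_pr2,
    ?pair_pr1_comp, ?pair_pr2_comp, ?comp_id_l, ?comp_id_r, ?pair_pr;
  reflexivity.

Lemma lens_comp_id_l {C : CartSymStrictMonCat} (X Y : C * C) (f : Lens X Y) :
  lens_comp (lens_id X) f = f.
Proof.
  destruct f as [f f']; unfold lens_comp, lens_id; cbn; f_equal;
    [apply comp_id_l | product_normalize].
Qed.

Lemma lens_comp_id_r {C : CartSymStrictMonCat} (X Y : C * C) (f : Lens X Y) :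
  lens_comp f (lens_id Y) = f.
Proof.
  destruct f as [f f']; unfold lens_comp, lens_id; cbn; f_equal;
    [apply comp_id_r | product_normalize].
Qed.

Lemma lens_comp_assoc {C : CartSymStrictMonCat} (W X Y Z : C * C)
    (f : Lens W X) (g : Lens X Y) (h : Lens Y Z) :
  lens_comp (lens_comp f g) h = lens_comp f (lens_comp g h).
Proof.
  unfold lens_comp; cbn; f_equal; [apply comp_assoc | product_normalize].
Qed.

Definition LensCart (C : CartSymStrictMonCat) : Category :=
  @Build_Category (C * C) (@Lens C) (@lens_id C) (@lens_comp C)
    (@lens_comp_id_l C) (@lens_comp_id_r C) (@lens_comp_assoc C).

(* Main.v *)
(** 2-cells of optics are determined by their residual maps, and a cast along an
    equality of lenses has the identity as residual map.  So every oplax axiom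
    becomes an identity of [C] between tuples of projections: coassociativity
    and counitality of the diagonal. *)

Require Import Defs.

Section CartesianGraph.
Context {C : CartSymStrictMonCat}.

(** Backward condition of the opunitor: the identity lens puts by [pr2]. *)
Lemma tensm_unitl_pr2 (X Y : C) : (bang X ⊗m idm Y) ;; unitl Y = pr2 X Y.
Proof. symmetry; apply pr2_unit. Qed.

Lemma graph_bang (X : C) : graph (idm X) ;; (bang X ⊗m idm X) = unitl' X.
Proof.
  unfold unitl'.
  (* Inserting the unitor and its inverse turns discarding the first factor into [pr2]. *)
  rewrite <- (comp_id_r (_ ;; _)), <- (idcast_inv_r (tens_unit_l X)), <- comp_assoc.
  rewrite (comp_assoc (graph _)), <- pr2_unit, graph_pair, pair_pr2.
  apply comp_id_l.
Qed.

(** Both sides are the triple of [idm X], [f] and [f ;; g]. With the associator on the left this is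
    the oplax associativity axiom; moved to the right it becomes the forward condition of the
    oplaxator. *)
Lemma graph_comp_α (X Y Z : C) (f : Hom X Y) (g : Hom Y Z) :
  graph (f ;; g) ;; (graph f ⊗m idm Z) ;; α X Y Z
  = graph f ;; (idm X ⊗m graph g).
Proof.
  rewrite !tensm_pair, !graph_pair, α_pair.
  repeat rewrite ?comp_assoc, ?comp_pair, ?pair_pr1, ?pair_pr2,
    ?pair_pr1_comp, ?pair_pr2_comp, ?comp_id_l, ?comp_id_r.
  reflexivity.
Qed.

Lemma graph_comp (X Y Z : C) (f : Hom X Y) (g : Hom Y Z) :
  graph (f ;; g) ;; (graph f ⊗m idm Z)
  = graph f ;; (idm X ⊗m graph g) ;; α' X Y Z.
Proof.
  rewrite <- graph_comp_α, (comp_assoc _ (α _ _ _)); unfold α, α'.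
  now rewrite idcast_inv_r, comp_id_r.
Qed.

Definition lens_optic {X Y : C * C} (l : Lens X Y) : Optic X Y :=
  @mkOptic C X Y (fst X) (graph (get l)) (put l).

Definition lens_oplaxator {X Y Z : C * C} (f : Lens X Y) (g : Lens Y Z) :
  Reparam (lens_optic (lens_comp f g)) (optic_comp (lens_optic f) (lens_optic g)).
Proof.
  refine (@mkReparam C X Z (lens_optic (lens_comp f g))
    (optic_comp (lens_optic f) (lens_optic g)) (graph (get f)) _ _); cbn.
  - apply graph_comp.
  (* The [put] of a composite lens is already [graph (get f)] followed by the backward map of the
     composite optic. *)
  - now rewrite !comp_assoc.
Defined.

Definition lens_opunitor (X : C * C) :
  Reparam (lens_optic (lens_id X)) (optic_id X) :=
  @mkReparam C X X (lens_optic (lens_id X)) (optic_id X) (bang (fst X))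
    (graph_bang (fst X)) (tensm_unitl_pr2 (fst X) (snd X)).

(** A 2-cell between lenses is an equality, so its image is a cast; both residuals are [fst X],
    hence the cast is trivial there. *)
Definition lens_optic_eq {X Y : C * C} {l l' : Lens X Y} (e : l = l') :
  @Hom (OpticHom X Y) (lens_optic l) (lens_optic l') :=
  @idcast (OpticHom X Y) _ _ (f_equal lens_optic e).

Lemma reparam_lens_optic_eq {X Y : C * C} {l l' : Lens X Y} (e : l = l') :
  reparam (lens_optic_eq e) = idm (fst X).
Proof. now destruct e. Qed.

Definition lens_oplax_functor :
  @OplaxFunctor (locally_discrete (LensCart C)) (TwoOptic C)
    (fun X : C * C => X) (@lens_optic).
Proof.
  refine (@Build_OplaxFunctor (locally_discrete (LensCart C)) (TwoOptic C)
    (fun X : C * C => X) (@lens_optic)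
    (@lens_optic_eq) _ _ (@lens_oplaxator) lens_opunitor _ _ _ _).
  - reflexivity.
  - intros X Y l l' l'' e e'; destruct e, e'; symmetry; apply comp_id_l.
  - intros X Y Z p p' q q' e e'; destruct e, e'; apply Reparam_eq; cbn.
    now rewrite reparam_lens_optic_eq, tensm_id, comp_id_l, comp_id_r.
  - intros W X Y Z p q r; apply Reparam_eq.
    cbn -[lens_optic_eq].
    rewrite (reparam_idcast (optic_comp_assoc _ _ _) (tens_assoc _ _ _)).
    rewrite reparam_lens_optic_eq, comp_id_l.
    apply graph_comp_α.
  - intros X Y p; apply Reparam_eq.
    cbn -[lens_optic_eq].
    rewrite (reparam_idcast (optic_comp_id_l _) (tens_unit_l _)).
    rewrite reparam_lens_optic_eq, comp_assoc; cbn.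
    (* Counit law: the second component of [graph (idm _)] is the identity. *)
    now rewrite <- pr2_unit, graph_pair, pair_pr2.
  - intros X Y p; apply Reparam_eq.
    cbn -[lens_optic_eq].
    rewrite (reparam_idcast (optic_comp_id_r _) (tens_unit_r _)).
    rewrite reparam_lens_optic_eq, comp_assoc; cbn.
    (* The first component of any graph is the identity. *)
    now rewrite <- pr1_unit, graph_pair, pair_pr1.
Defined.

End CartesianGraph.

Theorem theorem2 (C : CartSymStrictMonCat) :
  exists iota : @OplaxFunctor (locally_discrete (LensCart C)) (TwoOptic C)
      (fun X : C * C => X)
      (fun (X Y : C * C) (l : Lens X Y) =>
         @mkOptic C X Y (fst X) (graph (get l)) (put l)),
    (forall (X Y Z : C * C) (f : Lens X Y) (g : Lens Y Z),
       reparam (oplaxator iota (A := X) (B := Y) (C := Z) f g) = graph (get f)) /\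
    (forall X : C * C, reparam (opunitor iota X) = bang (fst X)).
Proof.
  exists lens_oplax_functor; split; reflexivity.
Qed.
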